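(* For every integer $k\geq 1$, let $Q(2k)$ be the number of quasipolarities of $\mathbb{Z}/2k\mathbb{Z}$, and let $\sigma^{*}_{1}(k):=\sum_{d\,||\,k}d$ be the sum of the unitary (positive) divisors of $k$. Then \[ Q(2k)=\sigma^{*}_{1}(k). \]
   Context: For $n\geq 1$, an element $(u,v)$ of the semidirect product $(\mathbb{Z}/n\mathbb{Z})\rtimes(\mathbb{Z}/n\mathbb{Z})^{\times}$ is denoted $e^{u}.v$ and acts on $\mathbb{Z}/n\mathbb{Z}$ as the affine bijection $e^{u}.v(x)=vx+u$. Such an $e^{u}.v$ is called a quasipolarity of $\mathbb{Z}/n\mathbb{Z}$ if, as a map on $\mathbb{Z}/n\mathbb{Z}$, it satisfies $(e^{u}.v)\circ(e^{u}.v)=\mathrm{Id}$ and has no fixed points. A positive divisor $d$ of $n$ is called unitary, written $d\,||\,n$, if $\gcd(d,n/d)=1$. *)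

(* Defs.v *)
From HB Require Import structures.
From mathcomp Require Import all_boot all_order all_algebra all_fingroup.

Set Implicit Arguments.
Unset Strict Implicit.
Unset Printing Implicit Defensive.

Import GRing.Theory.

Local Open Scope ring_scope.

(* The semidirect product of Z/nZ by (Z/nZ)^*, for the action by
   multiplication.  The element e^u.v is represented by the pair (v, u), unit
   part first.  Actions are on the right in fingroup, so the group law is
   opposite to that of composition of maps (see affmapM).
   Pitfall: 'Z_n is the ring Z/nZ only for n >= 2. *)
Definition affine_group (n : nat) : finGroupType :=
  sdprod_by (FinRing.unit_groupAction 'Z_n).

Definition affmap (n : nat) (g : affine_group n) (x : 'Z_n) : 'Z_n :=
  let: (v, u) := pair_of_sd g in val v * x + u.

Lemma affmapM (n : nat) (g h : affine_group n) (x : 'Z_n) :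
  affmap (g * h)%g x = affmap h (affmap g x).
Proof.
case: g h => [[v u] vu] [[v' u'] vu'].
rewrite /affmap /= mulrDr mulrA (mulrC (val v)) -addrA.
by congr (_ + (_ + _)); rewrite mulrC.
Qed.

Definition quasipolarity (n : nat) (g : affine_group n) : bool :=
  [forall x, affmap g (affmap g x) == x] && [forall x, affmap g x != x].

Definition num_quasipolarities (n : nat) : nat :=
  #|[set g : affine_group n | quasipolarity g]|.

Definition unitary_divisor (d n : nat) : bool :=
  (d %| n)%N && (gcdn d (n %/ d) == 1%N).

Definition sum_unitary_divisors (k : nat) : nat :=
  (\sum_(d <- divisors k | unitary_divisor d k) d)%N.

(* Main.v *)
(** If e^u.v is a quasipolarity of Z/2kZ then v is odd, v = 2w + 1 with
    0 <= w < k.  Put d = gcd(w, k) and e = gcd(w + 1, k), which are coprime.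
    Being an involution means k | (w + 1) u and k | 2w(w + 1); having no fixed
    point means that 2d does not divide u.  Hence k is d e or 2 d e, and in the
    latter case the first condition would give 2d | u.  So k = d e and u is an
    odd multiple of d, which leaves e choices modulo 2k.  By the Chinese
    remainder theorem, w |-> e is a bijection from the w with k | w(w + 1) onto
    the unitary divisors of k. *)

Require Import Defs.
From mathcomp Require Import all_boot all_order all_algebra all_fingroup.
From mathcomp Require Import zify.

Set Implicit Arguments.
Unset Strict Implicit.
Unset Printing Implicit Defensive.

Lemma coprime_gcdMl (a b k : nat) :
  coprime a b -> gcdn (a * b) k = gcdn a k * gcdn b k.
Proof.
move=> cab; apply/eqP; rewrite eqn_dvd; apply/andP; split.
  rewrite muln_gcdl dvdn_gcd !muln_gcdr !dvdn_gcd dvdn_gcdl /=.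
  by rewrite (dvdn_mull _ (dvdn_gcdr _ _)) !(dvdn_mulr _ (dvdn_gcdr _ _)).
rewrite dvdn_gcd dvdn_mul ?dvdn_gcdl //= Gauss_dvd ?dvdn_gcdr //.
exact: coprime_dvdl (dvdn_gcdl a k) (coprime_dvdr (dvdn_gcdl b k) cab).
Qed.

(** As [w] and [w.+1] are coprime, the gcd of their product with [k] splits into the two factors [d]
    and [e]. *)
Lemma dvd_mulS_gcd (k w : nat) :
  (k %| w * w.+1) = (gcdn w k * gcdn w.+1 k == k).
Proof. by rewrite -coprime_gcdMl ?coprimenS // gcdnC; apply/gcdn_idPl/eqP. Qed.

(** A multiple of the Bezout relation [k %| gcdn k w + a * w]. It produces a fixed point when
    [2 * gcdn w k] divides [u]. *)
Lemma dvd_gcd_solvable (k w m : nat) : 0 < k ->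
  gcdn w k %| m -> exists x, k %| w * x + m.
Proof.
move=> k0 /dvdnP[t ->]; case: (Bezoutl w k0) => a _ ka.
exists (a * t); rewrite (_ : _ + _ = (gcdn k w + a * w) * t) ?dvdn_mulr //.
by rewrite mulnDl gcdnC addnC mulnCA mulnA [t * _]mulnC.
Qed.

(* For [v = 2 * w + 1], the condition for e^u.v to be a quasipolarity of
   Z/2kZ. *)
Definition quasi_coeffs (k w u : nat) : bool :=
  [&& k %| w * w.+1, gcdn w k %| u & ~~ (2 * gcdn w k %| u)].

Lemma eqn_mod_addr (n x y : nat) : (x + y == x %[mod n]) = (n %| y).
Proof. by rewrite -[in X in _ == X](addn0 x) eqn_modDl mod0n. Qed.

(** Applying the map twice displaces [x] by an even amount, so a factor 2 cancels against the
    modulus [2 * k]. *)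
Lemma affine_oddE (w u x : nat) :
  w.*2.+1 * (w.*2.+1 * x + u) + u = x + 2 * (2 * (w * w.+1 * x) + w.+1 * u).
Proof. by nia. Qed.

Lemma quasi_coeffsP (k v u : nat) : 0 < k ->
  (forall x, v * (v * x + u) + u = x %[mod 2 * k]) /\
  (forall x, v * x + u <> x %[mod 2 * k]) <->
  odd v /\ quasi_coeffs k v./2 u.
Proof.
move=> k0; set w := v./2.
have fixE x : odd v -> (v * x + u == x %[mod 2 * k]) = (2 * k %| 2 * w * x + u).
  move=> ov; rewrite -(odd_double_half v) ov -/w.
  by rewrite (_ : _ + u = x + (2 * w * x + u)) ?eqn_mod_addr //; lia.
split=> [[inv nofix]|[ov /and3P[kw du ndu]]].
  have ov : odd v.
    (* Modulo 2, an even [v] would make [u] even by the value at 0 and odd by the value at 1. *)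
    have := congr1 odd (inv 0); have := congr1 odd (inv 1).
    rewrite !odd_mod ?oddM //= muln0 add0n muln1 !(oddD, oddM).
    by case: (odd v); case: (odd u).
  have invE x : k %| 2 * (w * w.+1 * x) + w.+1 * u.
    rewrite -(@dvdn_pmul2l 2) // -(@eqn_mod_addr _ x) -affine_oddE.
    by have /eqP := inv x; rewrite -{1 2}(odd_double_half v) ov.
  (* The point 0 gives [k %| w.+1 * u]; subtracting this at the point 1 leaves
     [k %| 2 * (w * w.+1)]. *)
  have := invE 0; rewrite !muln0 add0n => kwu.
  have := invE 1; rewrite muln1 dvdn_addl // => kww.
  have ndu : ~~ (2 * gcdn w k %| u).
    (* Since [2 * gcdn w k = gcdn (2 * w) (2 * k)], if it divided [u] then [2 * w * x + u] would
       vanish modulo [2 * k] for some [x]. *)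
    apply/negP; rewrite muln_gcdr => /dvd_gcd_solvable[|x]; first by lia.
    by rewrite -fixE // => /eqP/nofix.
  have keu : k %| gcdn w.+1 k * u by rewrite muln_gcdl dvdn_gcd kwu dvdn_mulr.
  have [m kE] : exists m, k = gcdn w k * gcdn w.+1 k * m.
    suff /dvdnP[m kE]: gcdn w k * gcdn w.+1 k %| k by exists m; rewrite mulnC.
    by rewrite -coprime_gcdMl ?coprimenS ?dvdn_gcdr.
  have e0 : 0 < gcdn w.+1 k by rewrite gcdn_gt0 k0 orbT.
  have d0 : 0 < gcdn w k by rewrite gcdn_gt0 k0 orbT.
  (* Cancel [e] in [d * e * m %| e * u]. This excludes [m = 2] below and yields [d %| u] once
     [m = 1]. *)
  have dmu : gcdn w k * m %| u.
    by rewrite -(dvdn_pmul2l e0) mulnA [_ * gcdn w k]mulnC -kE.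
  have m2 : m %| 2.
    have : k %| 2 * (gcdn w k * gcdn w.+1 k).
      by rewrite -coprime_gcdMl ?coprimenS // muln_gcdr dvdn_gcd kww dvdn_mull.
    by rewrite {1}kE [2 * _]mulnC dvdn_pmul2l // muln_gt0 d0.
  have m1 : m = 1.
    case/primeP: (isT : prime 2) => _ /(_ m m2)/pred2P[// | mE].
    by case/negP: ndu; rewrite mulnC -mE.
  split=> //; apply/and3P; split=> //; last by rewrite m1 muln1 in dmu.
  by rewrite dvd_mulS_gcd {3}kE m1 muln1.
have vE : v = w.*2.+1 by rewrite -[LHS]odd_double_half ov.
split=> x.
  apply/eqP; rewrite vE affine_oddE eqn_mod_addr dvdn_pmul2l //.
  apply: dvdn_add; first by apply/dvdn_mull/dvdn_mulr.
  move: kw; rewrite dvd_mulS_gcd => /eqP {1}<-.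
  by rewrite mulnC dvdn_mul ?dvdn_gcdl.
apply/eqP; rewrite fixE //; apply: contra ndu => kx.
rewrite -(@dvdn_addr (2 * w * x)).
  by apply: dvdn_trans kx; rewrite dvdn_pmul2l ?dvdn_gcdr.
by rewrite -mulnA dvdn_pmul2l // dvdn_mulr ?dvdn_gcdl.
Qed.

(** These [u] are the [d * (2 * j + 1)] with [j < e]. *)
Lemma card_odd_multiples (d e : nat) : 0 < d ->
  #|[set u : 'I_(2 * (d * e)) | (d %| u) && ~~ (2 * d %| u)]| = e.
Proof.
move=> d0.
have lt_h (j : 'I_e) : d * j.*2.+1 < 2 * (d * e).
  by rewrite mulnCA ltn_pmul2l //; have := ltn_ord j; lia.
pose h (j : 'I_e) := Ordinal (lt_h j).
rewrite -[RHS]card_ord -(@card_imset _ _ h) => [|i j /(congr1 val)/= /eqP].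
  apply: eq_card => u; rewrite inE; apply/idP/imsetP=> [/andP[/dvdnP[t uE] nu]|].
    have ot : odd t.
      by move: nu; rewrite uE dvdn_pmul2r // dvdn2 negbK.
    have lt_t : t./2 < e.
      have := ltn_ord u; rewrite {1}uE mulnC mulnCA ltn_pmul2l //.
      by rewrite -{1}(odd_double_half t) ot; lia.
    exists (Ordinal lt_t) => //; apply: val_inj => /=.
    by rewrite uE mulnC -{1}(odd_double_half t) ot.
  case=> j _ -> /=; rewrite dvdn_mulr //= mulnC dvdn_pmul2l // dvdn2 /=.
  by rewrite odd_double.
rewrite eqn_pmul2l // eqSS => /eqP/double_inj; exact: val_inj.
Qed.

(** Both sides sum duplicate-free lists, which are permutations of each other through
    [w |-> gcdn w.+1 k]. *)
Lemma sum_unitary_divisors_gcd (k : nat) : 0 < k ->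
  sum_unitary_divisors k = \sum_(w < k | k %| w * w.+1) gcdn w.+1 k.
Proof.
move=> k0; rewrite /sum_unitary_divisors -big_filter.
rewrite -(big_mkord (fun w => k %| w * w.+1) (fun w => gcdn w.+1 k)).
rewrite -[RHS]big_filter -(big_map (fun w => gcdn w.+1 k) xpredT id).
apply/perm_big/uniq_perm; first by rewrite filter_uniq ?divisors_uniq.
  rewrite map_inj_in_uniq ?filter_uniq ?iota_uniq // => w w'.
  rewrite !mem_filter !mem_index_iota /= !dvd_mulS_gcd.
  move=> /andP[/eqP kw ltw] /andP[/eqP kw' ltw'] eqe.
  have e0 : 0 < gcdn w.+1 k by rewrite gcdn_gt0 k0 orbT.
  have eqd : gcdn w k = gcdn w' k.
    by apply/eqP; rewrite -(eqn_pmul2r e0) kw eqe kw'.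
  have cde : coprime (gcdn w k) (gcdn w.+1 k).
    apply: coprime_dvdl (dvdn_gcdl _ _) (coprime_dvdr (dvdn_gcdl _ _) _).
    exact: coprimenS.
  (* Both are 0 modulo [d] and -1 modulo [e], and [d * e = k]. *)
  have: w == w' %[mod gcdn w k * gcdn w.+1 k].
    rewrite chinese_remainder //; apply/andP; split.
      rewrite (eqP (dvdn_gcdl w k)) eqd.
      by rewrite (eqP (dvdn_gcdl w' k)).
    rewrite -(eqn_modDr 1) !addn1 (eqP (dvdn_gcdl w.+1 k)) eqe.
    by rewrite (eqP (dvdn_gcdl w'.+1 k)).
  by rewrite kw !modn_small // => /eqP.
move=> e; rewrite mem_filter -dvdn_divisors //; apply/idP/mapP; last first.
  case=> w; rewrite mem_filter dvd_mulS_gcd => /andP[/eqP kw _] ->.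
  rewrite /unitary_divisor dvdn_gcdr /= andbT -[X in X %/ _]kw mulnK.
    have : coprime w.+1 w by exact: coprimeSn.
    move/(coprime_dvdl (dvdn_gcdl w.+1 k)).
    exact/coprime_dvdr/dvdn_gcdl.
  by rewrite gcdn_gt0.
case/andP=> /andP[_ cef] /dvdnP[f kE].
have e0 : 0 < e by case: e k0 kE {cef} => //; lia.
have {}cef : coprime e f by move: cef; rewrite {1}kE mulnK.
(* The preimage of [e] is 0 modulo [f = k / e] and -1 modulo [e], the latter written [e.-1];
   reducing modulo [k] puts it in range. *)
pose w := chinese e f e.-1 0 %% k.
have ew : e %| w.+1.
  have : w == e.-1 %[mod e].
    by rewrite modn_dvdm ?kE ?dvdn_mull // chinese_modl.
  by rewrite -(eqn_modDr 1) !addn1 prednK // modnn.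
have fw : f %| w.
  have : w == 0 %[mod f].
    by rewrite modn_dvdm ?kE ?dvdn_mulr // chinese_modr.
  by rewrite mod0n.
exists w; first by rewrite mem_filter mem_index_iota ltn_mod k0 {1}kE dvdn_mul.
(* [f] divides [w], hence is coprime to [w.+1] and drops out of the gcd. *)
rewrite kE Gauss_gcdr; first by apply/esym/gcdn_idPr.
exact: coprime_dvdr fw (coprimeSn w).
Qed.

Lemma Zp_natr_eq (n : nat) (a b : nat) : 1 < n ->
  (a%:R == b%:R :> 'Z_n)%R = (a == b %[mod n]).
Proof. by move=> n1; rewrite -val_eqE /= !val_Zp_nat. Qed.

Definition linear_part (n : nat) (g : affine_group n) : 'Z_n :=
  val (pair_of_sd g).1.

Definition translation_part (n : nat) (g : affine_group n) : 'Z_n :=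
  (pair_of_sd g).2.

Lemma affmapE (n : nat) (g : affine_group n) (x : 'Z_n) :
  affmap g x = (linear_part g * x + translation_part g)%R.
Proof. by rewrite /affmap /linear_part /translation_part; case: pair_of_sd. Qed.

Lemma affine_group_inj (n : nat) (g h : affine_group n) :
  linear_part g = linear_part h -> translation_part g = translation_part h ->
  g = h.
Proof.
case: g h => [[v u] vu] [[v' u'] vu']; rewrite /linear_part /translation_part /=.
by move=> /val_inj vv' uu'; apply: val_inj; rewrite /= vv' uu'.
Qed.

Lemma affine_group_surj (n : nat) (v u : 'Z_n) : (v \is a GRing.unit)%R ->
  exists g : affine_group n, linear_part g = v /\ translation_part g = u.
Proof.
move=> vU; pose p := (FinRing.Unit vU, u).
have pP : p \in setX [set: {unit 'Z_n}] [set: 'Z_n] by rewrite !inE.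
by exists (SdPair (FinRing.unit_groupAction 'Z_n) pP).
Qed.

Lemma quasipolarityE (k : nat) (g : affine_group (2 * k)) : 0 < k ->
  quasipolarity g =
  odd (linear_part g) && quasi_coeffs k (linear_part g)./2 (translation_part g).
Proof.
move=> k0; have n1 : 1 < 2 * k by lia.
set v := linear_part g; set u := translation_part g.
have affmap_nat x : affmap g (x%:R)%R = ((v * x + u)%N%:R)%R.
  by rewrite affmapE GRing.natrD GRing.natrM !natr_Zp.
apply/andP/andP=> [[/forallP inv /forallP nofix]|].
  apply/(quasi_coeffsP _ _ k0); split=> x.
    by apply/eqP; rewrite -Zp_natr_eq // -!affmap_nat inv.
  by apply/eqP; rewrite -Zp_natr_eq // -affmap_nat nofix.
move/(quasi_coeffsP _ _ k0)=> [inv nofix].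
split; apply/forallP=> x; rewrite -[x]natr_Zp !affmap_nat Zp_natr_eq //;
  exact/eqP.
Qed.

Lemma ltn_Zp (n : nat) (x : 'Z_n) : 1 < n -> x < n.
Proof. by move=> n1; rewrite -[X in _ < X](Zp_cast n1). Qed.

(** Sending e^u.v to [(v./2, u)] loses nothing, because [v] is odd for a quasipolarity. *)
Lemma num_quasipolarities_pairs (k : nat) : 0 < k ->
  num_quasipolarities (2 * k) =
  #|[set p : 'I_k * 'I_(2 * k) | quasi_coeffs k p.1 p.2]|.
Proof.
move=> k0; have n1 : 1 < 2 * k by lia.
have lt_half (g : affine_group (2 * k)) : (linear_part g)./2 < k.
  by have := ltn_Zp (linear_part g) n1; rewrite ltn_half_double -mul2n.
pose f (g : affine_group (2 * k)) : 'I_k * 'I_(2 * k) :=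
  (Ordinal (lt_half g), Ordinal (ltn_Zp (translation_part g) n1)).
rewrite /num_quasipolarities -(@card_in_imset _ _ f) => [|g h].
  apply: eq_card => -[w u]; rewrite inE; apply/imsetP/idP=> [[g]|wu].
    by rewrite inE quasipolarityE // => /andP[_ Qg] ->.
  pose v := w.*2.+1.
  have ltv : v < 2 * k by rewrite /v; have := ltn_ord w; lia.
  have ov : odd v by rewrite /v /= odd_double.
  have v2 : v./2 = w by rewrite /v /= uphalf_double.
  (* [v] is its own inverse: its square is [1 + 4 * w * w.+1], and [k %| w * w.+1]. *)
  have vU : ((v%:R : 'Z_(2 * k)) \is a GRing.unit)%R.
    rewrite unitZpE // coprime_sym; apply: modn_coprime => //.
    exists v; have /and3P[kw _ _] := wu.
    apply/eqP; rewrite -[X in _ == X](modn_small n1).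
    have := affine_oddE w 0 1; rewrite !muln0 !addn0 !muln1 -/v => ->.
    by rewrite eqn_mod_addr dvdn_pmul2l // dvdn_mull.
  have [g [gv gu]] := affine_group_surj (inZp u) vU.
  have {}gv : linear_part g = v :> nat by rewrite gv val_Zp_nat ?modn_small.
  have {}gu : translation_part g = u :> nat.
    by rewrite gu /= Zp_cast ?modn_small.
  exists g; first by rewrite inE quasipolarityE // gv gu v2 ov.
  by congr pair; apply: val_inj; rewrite /= ?gv ?gu ?v2.
rewrite !inE !quasipolarityE // => /andP[ov _] /andP[ov' _] [vv' uu'].
apply: affine_group_inj; apply: val_inj => //=.
by rewrite -[LHS]odd_double_half -[RHS]odd_double_half ov ov' vv'.
Qed.

Theorem proposition2p3 (k : nat) (hk : (1 <= k)%N) :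
  num_quasipolarities (2 * k) = sum_unitary_divisors k.
Proof.
rewrite num_quasipolarities_pairs // sum_unitary_divisors_gcd //.
rewrite -sum1_card.
under eq_bigl => p do rewrite inE /quasi_coeffs.
rewrite -(pair_big_dep (fun w : 'I_k => k %| w * w.+1)
  (fun w (u : 'I_(2 * k)) => (gcdn w k %| u) && ~~ (2 * gcdn w k %| u)) (fun _ _ => 1)) /=.
apply: eq_bigr => w; rewrite dvd_mulS_gcd => /eqP kw.
have d0 : 0 < gcdn w k by rewrite gcdn_gt0 hk orbT.
(* The summand [e] is turned back into a count of odd multiples of [d] below
   [2 * (d * e) = 2 * k]. *)
rewrite -[RHS](card_odd_multiples _ d0) kw sum1_card.
by apply: eq_card => u; rewrite inE.
Qed.
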